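(* The complete bipartite graph $K_{3,3}$ is not isomorphic to the rook equivalence graph $G(B)$ of any Ferrers board $B$.
   Context: A Ferrers board is given by a weakly increasing sequence of non-negative integers $B=(b_1,\ldots,b_n)$ of column heights; it is the set of unit cells in the first quadrant lying in column $i$ and rows $1,\ldots,b_i$. Prepending columns of height $0$ on the left does not change the board, and boards are compared using the same number of columns by such padding. A placement of $k$ rooks on $B$ is a set of $k$ cells of $B$ no two in the same row or column; $r_k(B)$ is the number of such placements. Two boards are rook equivalent if they have equal $r_k$ for all $k\ge 0$. The rook equivalence graph $G(B)$ has as vertices all Ferrers boards rook equivalent to $B$, and $\{B_1,B_2\}$ is an edge iff, written with the same number of columns, $B_1$ and $B_2$ differ in exactly two columns $i$ and $j$, where $B_1$ has $k$ more cells than $B_2$ in column $i$ and $k$ fewer cells than $B_2$ in column $j$, for some $k>0$. *)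

(* Defs.v *)
From mathcomp Require Import all_boot.
Set Implicit Arguments. Unset Strict Implicit. Unset Printing Implicit Defensive.

(* A Ferrers board is a weakly increasing sequence of column heights
   b = (b_1,...,b_n); column i (0-based here) consists of the cells in rows
   0 .. b_i - 1. *)
Definition ferrers (b : seq nat) : bool := sorted leq b.

(* Canonical representative of a board modulo prepending zero columns:
   a Ferrers board with no zero column. *)
Definition reduced_ferrers (b : seq nat) : bool := ferrers b && all (fun h => 0 < h) b.

Definition pad (n : nat) (b : seq nat) : seq nat := nseq (n - size b) 0 ++ b.

(* Cells of b, as pairs (column, row); rows bounded by sumn b. *)
Definition is_cell (b : seq nat) (c : 'I_(size b) * 'I_(sumn b)) : bool :=
  c.2 < nth 0 b c.1.

Definition nonattacking (b : seq nat) (P : {set 'I_(size b) * 'I_(sumn b)}) : bool :=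
  [forall p in P, forall q in P, (p != q) ==> ((p.1 != q.1) && (p.2 != q.2))].

Definition rook_number (b : seq nat) (k : nat) : nat :=
  #|[set P : {set 'I_(size b) * 'I_(sumn b)} |
      [&& P \subset [set c | is_cell c], nonattacking P & #|P| == k]]|.

Definition rook_equiv (b1 b2 : seq nat) : Prop :=
  forall k, rook_number b1 k = rook_number b2 k.

Definition rook_vertex (B C : seq nat) : Prop :=
  reduced_ferrers C /\ rook_equiv B C.

Definition rook_edge (b1 b2 : seq nat) : Prop :=
  let n := maxn (size b1) (size b2) in
  let p1 := pad n b1 in let p2 := pad n b2 in
  exists i j k, [/\ i < n, j < n, i != j & 0 < k] /\
    [/\ nth 0 p1 i = nth 0 p2 i + k, nth 0 p1 j + k = nth 0 p2 j &
    forall l, l < n -> l != i -> l != j -> nth 0 p1 l = nth 0 p2 l].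

Definition K33_adj (a b : 'I_6) : Prop := (a < 3) != (b < 3).

Definition rook_graph_iso_K33 (B : seq nat) : Prop :=
  exists f : 'I_6 -> seq nat,
    [/\ injective f,
        (forall a, rook_vertex B (f a)),
        (forall C, rook_vertex B C -> exists a, f a = C) &
        (forall a b, rook_edge (f a) (f b) <-> K33_adj a b)].

(* Main.v *)
Require Import Defs.
From mathcomp Require Import all_boot all_order all_algebra zify ring.
Import Order.TTheory GRing.Theory Num.Theory.

Set Implicit Arguments.
Unset Strict Implicit.
Unset Printing Implicit Defensive.

(** By Goldman, Joichi and White, rook equivalence of two boards with the same
    number of columns means that their excess words [e_i = b_i - i] are
    rearrangements of each other; being a board means [e_i <= e_(i+1) + 1], and
    an edge of the rook graph is a transposition of two distinct letters.
    In a [K_{3,3}] of rearrangements joined by transpositions, two words on the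
    same side with three pairwise non-adjacent common neighbours must differ in
    exactly three positions, and all six words agree outside three common
    positions [p < q < s], where they realise all arrangements of letters
    [x < y < z].  The board with [z] at [p] and [x] at [q] forces positions
    strictly between [p] and [q], with first letter [>= z - 1] and last letter
    [<= x + 1].  Hence in the board with [x, y, z] at [p, q, s] the letter [x]
    may be moved just before [q], a seventh vertex. *)

(** * Rook numbers of a board with a new last column *)

Lemma nth_le_sumn b i : nth 0 b i <= sumn b.
Proof. by elim: b i => [|x b IH] [|i] //=; [lia | have:=IH i; lia]. Qed.

(** The grid size is a parameter here, so that placements on boards of different sizes live in one
    type and can be compared. *)
Definition attack_free (N M : nat) (P : {set 'I_N * 'I_M}) : bool :=
  [forall p in P, forall q in P, (p != q) ==> ((p.1 != q.1) && (p.2 != q.2))].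

Definition placements (N M : nat) (b : seq nat) (k : nat) : {set {set 'I_N * 'I_M}} :=
  [set P : {set 'I_N * 'I_M} | [&& P \subset [set c : 'I_N * 'I_M | c.2 < nth 0 b c.1],
               attack_free P & #|P| == k]].

Lemma rook_numberE b k : rook_number b k = #|placements (size b) (sumn b) b k|.
Proof. by []. Qed.

Lemma attack_freeP N M (P : {set 'I_N * 'I_M}) :
  reflect {in P &, forall p q, p != q -> p.1 != q.1 /\ p.2 != q.2} (attack_free P).
Proof.
apply: (iffP forall_inP) => [H p q pP qP npq | H p pP].
  by move/forall_inP: (H p pP) => /(_ q qP); rewrite npq => /andP.
by apply/forall_inP => q qP; apply/implyP => npq; apply/andP; apply: H.
Qed.

Lemma attack_free_sub N M (P Q : {set 'I_N * 'I_M}) :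
  P \subset Q -> attack_free Q -> attack_free P.
Proof.
move=> /subsetP PQ /attack_freeP H; apply/attack_freeP => p q pP qP.
by apply: H; apply: PQ.
Qed.

(** Columns past the end have default height 0 and all heights are at most [M], so every cell of [b]
    lies in the smaller grid. Hence each placement in the larger grid is the image of one in the
    smaller. *)
Lemma card_placements_widen N M N' M' b k : N <= N' -> M <= M' ->
    size b <= N -> (forall i, nth 0 b i <= M) ->
  #|placements N' M' b k| = #|placements N M b k|.
Proof.
move=> NN MM bN bM.
pose f (c : 'I_N * 'I_M) := (widen_ord NN c.1, widen_ord MM c.2).
have fI : injective f.
  move=> [a b1] [c d] [] ac bd; congr pair; exact: val_inj.
have attf (P : {set 'I_N * 'I_M}) : attack_free (f @: P) = attack_free P.
  apply/attack_freeP/attack_freeP => H p q.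
    move=> pP qP npq; have := H (f p) (f q) (imset_f f pP) (imset_f f qP).
    by rewrite (inj_eq fI) npq => /(_ isT).
  by move=> /imsetP[x xP ->] /imsetP[y yP ->]; rewrite (inj_eq fI); apply: H.
rewrite -(card_imset _ (imset_inj fI)); apply: eq_card => P.
apply/idP/imsetP => [|[Q + ->]]; rewrite !inE.
  move=> /and3P[/subsetP sP aP cP].
  have PE : P = f @: (f @^-1: P).
    apply/setP => -[x y]; apply/idP/imsetP => [xyP | [c + ->]]; last by rewrite inE.
    have := sP _ xyP; rewrite inE /= => yb.
    have xN : x < N.
      by apply: leq_trans bN; rewrite ltnNge; apply/negP => /(nth_default 0); lia.
    have yM : y < M by apply: leq_trans (bM x).
    have E : f (Ordinal xN, Ordinal yM) = (x, y) by congr pair; exact: val_inj.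
    by exists (Ordinal xN, Ordinal yM); rewrite // inE E.
  exists (f @^-1: P) => //; rewrite inE -attf -PE aP.
  rewrite -(card_imset _ fI) -PE cP !andbT; apply/subsetP => c.
  by rewrite !inE => /sP; rewrite inE.
move=> /and3P[/subsetP sQ aQ cQ]; rewrite attf aQ (card_imset _ fI) cQ !andbT.
by apply/subsetP => _ /imsetP[c cQ' ->]; have := sQ _ cQ'; rewrite !inE.
Qed.

Lemma rook_number_widen N M b k : size b <= N -> (forall i, nth 0 b i <= M) ->
  rook_number b k = #|placements N M b k|.
Proof.
move=> bN bM; rewrite rook_numberE.
(* [M] and [sumn b] need not be comparable in a known direction, so both grids are embedded in a
   common larger one. *)
rewrite -(@card_placements_widen _ _ (size b + N) (sumn b + M)) ?leq_addr //.
  by apply: card_placements_widen; rewrite // leq_addl.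
exact: nth_le_sumn.
Qed.

Lemma rook_number0 b : rook_number b 0 = 1.
Proof.
rewrite rook_numberE; apply/eqP/cards1P; exists set0; apply/setP => P.
rewrite !inE cards_eq0; apply/idP/eqP => [/and3P[_ _ /eqP]//|->].
by rewrite sub0set eqxx /= andbT; apply/attack_freeP => p q; rewrite inE.
Qed.

Lemma rook_number_nil k : rook_number [::] k = (k == 0).
Proof.
case: k => [|k]; first exact: rook_number0.
rewrite rook_numberE; apply/eqP; rewrite cards_eq0; apply/eqP/setP => P.
rewrite !inE; apply/negP => /and3P[_ _].
by rewrite eq_card0 // => -[[]].
Qed.

Lemma placement_col N M b k (P : {set 'I_N * 'I_M}) c :
  P \in placements N M b k -> c \in P -> c.1 < size b.
Proof.
rewrite inE => /and3P[/subsetP sP _ _] /sP; rewrite inE => cb.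
by rewrite ltnNge; apply/negP => /(nth_default 0) E; rewrite E in cb.
Qed.

Lemma card_free_rows N M (P : {set 'I_N * 'I_M}) h : h <= M -> attack_free P ->
    (forall c, c \in P -> c.2 < h) ->
  #|[set j : 'I_M | (j < h) && (j \notin snd @: P)]| + #|P| = h.
Proof.
move=> hM /attack_freeP aP hP.
have <- : #|snd @: P| = #|P|.
  apply: card_in_imset => p q pP qP E; apply/eqP/negP => /negP npq.
  by have [_] := aP p q pP qP npq; rewrite E eqxx.
have hE : #|[set j : 'I_M | j < h]| = h.
  have wI : injective (widen_ord hM) by move=> i j [/val_inj].
  rewrite -[RHS]card_ord -(card_imset _ wI).
  apply: eq_card => j; rewrite inE; apply/idP/imsetP => [jh | [i _ ->] /=] //.
  by exists (Ordinal jh) => //; apply: val_inj.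
rewrite -[RHS]hE addnC -(cardsID (snd @: P) [set j : 'I_M | j < h]); congr addn.
  apply: eq_card => j; rewrite !inE; apply/idP/andP => [jP|[]//]; split=> //.
  by case/imsetP: jP => c cP ->; apply: hP.
by apply: eq_card => j; rewrite !inE andbC.
Qed.

(** A placement of [k.+1] rooks either leaves the last column empty or has one rook there. In the
    second case the other [k] rooks occupy [k] of the [h] rows, since no earlier column is higher
    than [h], which leaves [h - k] rows. The term [k * rook_number b k] stands on the left to avoid
    truncated subtraction. *)
Lemma rook_number_rcons b h k : all (fun x => x <= h) b ->
  rook_number (rcons b h) k.+1 + k * rook_number b k =
  rook_number b k.+1 + h * rook_number b k.
Proof.
move=> /allP bh.
have nbh i : nth 0 b i <= h.
  by case: (ltnP i (size b)) => ib; [apply: bh; apply: mem_nth | rewrite nth_default].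
set n := size b; pose N := n.+1; pose M := sumn b + h.
have nbM i : nth 0 b i <= M by apply: leq_trans (nbh i) (leq_addl _ _).
have nM i : nth 0 (rcons b h) i <= M.
  by rewrite nth_rcons; case: ifP => // _; case: ifP => // _; apply: leq_addl.
have hM : h <= M by apply: leq_addl.
rewrite (@rook_number_widen N M (rcons b h)) ?size_rcons //.
rewrite !(@rook_number_widen N M b) //.
pose n0 : 'I_N := ord_max.
have ltn0 (i : 'I_N) : i != n0 -> i < n.
  by rewrite -val_eqE /= => i0; rewrite ltn_neqAle i0 -ltnS ltn_ord.
set X := placements N M (rcons b h) k.+1; set A := placements N M b k.+1.
set B := placements N M b k.
have sub_nth (c : 'I_N) : nth 0 b c <= nth 0 (rcons b h) c.
  by rewrite nth_rcons; case: ltnP => // cn; rewrite nth_default.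
have AX : A \subset X.
  apply/subsetP => P; rewrite !inE => /and3P[/subsetP sP -> ->]; rewrite !andbT.
  by apply/subsetP => c /sP; rewrite !inE => /leq_trans; apply.
rewrite -(cardsID A X) (setIidPr AX) -addnA; congr addn.
(* [Q] pairs a [k]-placement on [b] with a free row below [h], and [g] puts a rook in that row of
   the new column [n0]. The placements using the new column, [X :\: A], are counted through this
   bijection. *)
pose Q := [set Pj : {set 'I_N * 'I_M} * 'I_M |
  (Pj.1 \in B) && ((Pj.2 < h) && (Pj.2 \notin snd @: Pj.1))].
have QE P j : ((P, j) \in Q) = (P \in B) && ((j < h) && (j \notin snd @: P)).
  by rewrite inE.
pose g (Pj : {set 'I_N * 'I_M} * 'I_M) := (n0, Pj.2) |: Pj.1.
have n0P P c : P \in B -> c \in P -> (c.1 != n0).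
  by move=> PB cP; have := placement_col PB cP; rewrite neq_ltn => ->.
have gI : {in Q &, injective g}.
  move=> [P j] [P' j']; rewrite !QE => /andP[PB _] /andP[PB' _] E.
  have E1 : [set c in g (P, j) | c.1 != n0] = P.
    apply/setP => c; rewrite !inE /=; apply/andP/idP => [[/orP[/eqP->|//]]|cP].
      by rewrite eqxx.
    by rewrite cP orbT; split=> //; apply: n0P cP.
  have E2 : [set c in g (P', j') | c.1 != n0] = P'.
    apply/setP => c; rewrite !inE /=; apply/andP/idP => [[/orP[/eqP->|//]]|cP].
      by rewrite eqxx.
    by rewrite cP orbT; split=> //; apply: n0P cP.
  rewrite -E1 -E2 E; congr pair.
  have : (n0, j) \in g (P', j') by rewrite -E !inE eqxx.
  rewrite !inE => /orP[/eqP[]//| jP'].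
  by have := n0P _ _ PB' jP'; rewrite eqxx.
have rows P : P \in B -> forall c, c \in P -> c.2 < h.
  rewrite inE => /and3P[/subsetP sP _ _] c /sP; rewrite inE => /leq_trans; exact.
have -> : X :\: A = g @: Q.
  apply/setP => P; apply/idP/imsetP.
    rewrite !inE => /andP[nA /and3P[/subsetP sP aP cP]].
    have [c cP0 c0] : exists2 c, c \in P & c.1 = n0.
      case: (pickP [pred c | (c \in P) && (c.1 == n0)]) => [c /andP[cP0 /eqP c0]|nP].
        by exists c.
      case/negP: nA; rewrite aP cP !andbT; apply/subsetP => c cP0.
      have := sP _ cP0; rewrite !inE nth_rcons.
      have : c.1 < n by apply: ltn0; have := nP c; rewrite /= cP0 => /negbT.
      by move=> ->.
    exists (P :\ c, c.2); last by rewrite /g /= -c0 -surjective_pairing setD1K.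
    have aP' := attack_free_sub (subD1set P c) aP.
    have cP' : #|P :\ c| = k by move: cP; rewrite (cardsD1 c) cP0 => /eqP[].
    rewrite !inE /= aP' cP' eqxx !andbT; apply/and3P; split.
    - apply/subsetP => d; rewrite !inE => /andP[dc dP].
      have := sP _ dP; rewrite inE nth_rcons.
      move/attack_freeP: aP => /(_ d c dP cP0 dc) []; rewrite c0 => /ltn0 dn _.
      by rewrite dn.
    - by have := sP _ cP0; rewrite inE nth_rcons c0 /= ltnn eqxx.
    - apply/imsetP => -[d]; rewrite !inE => /andP[dc dP] E.
      by move/attack_freeP: aP => /(_ d c dP cP0 dc) []; rewrite E eqxx.
  move=> [[P' j]]; rewrite QE => /and3P[PB jh jP'] ->.
  have n0P' : (n0, j) \notin P' by apply/negP => /(n0P _ _ PB); rewrite eqxx.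
  move: (PB); rewrite !inE /g /= => /and3P[/subsetP sP aP cP].
  have -> : ((n0, j) |: P' \subset [set c : 'I_N * 'I_M | c.2 < nth 0 b c.1]) = false.
    apply/negP => /subsetP /(_ (n0, j)); rewrite !inE eqxx => /(_ isT) /=.
    by rewrite nth_default.
  rewrite /= cardsU1 n0P' (eqP cP) eqxx andbT; apply/andP; split.
    apply/subsetP => c; rewrite !inE => /orP[/eqP-> /=|/sP].
      by rewrite nth_rcons ltnn eqxx.
    by rewrite inE => /leq_trans; apply.
  apply/attack_freeP => p q; rewrite !inE => /orP[/eqP->|pP] /orP[/eqP->|qP].
  - by rewrite eqxx.
  - move=> _ /=; split; first by rewrite eq_sym; apply: n0P qP.
    by apply: contraNneq jP' => ->; apply: imset_f.
  - move=> _ /=; split; first by apply: n0P pP.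
    by apply: contraNneq jP' => <-; apply: imset_f.
  - by move/attack_freeP: aP; apply.
rewrite (card_in_imset gI) -sum1_card.
rewrite (eq_bigl (fun Pj : {set 'I_N * 'I_M} * 'I_M =>
  (Pj.1 \in B) && ((Pj.2 < h) && (Pj.2 \notin snd @: Pj.1)))); last first.
  by move=> Pj; rewrite inE.
rewrite -(pair_big_dep (fun P : {set 'I_N * 'I_M} => P \in B)
  (fun P (j : 'I_M) => (j < h) && (j \notin snd @: P)) (fun _ _ => 1)) /=.
(* Compared placement by placement: the free rows and the [k] occupied ones add up to [h]. *)
rewrite [k * _]mulnC [h * _]mulnC -!sum_nat_const -big_split /=; apply: eq_bigr => P PB.
have := rows _ PB; move: (PB); rewrite inE => /and3P[_ aP /eqP cP] hP.
by rewrite sum1dep_card -cP card_free_rows.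
Qed.

(** * The factorization theorem *)

Lemma sorted_leq_rcons b h :
  sorted leq (rcons b h) = all (fun x => x <= h) b && sorted leq b.
Proof. by rewrite !(sorted_pairwise leq_trans) pairwise_rcons. Qed.

Lemma rook_number_gt_size b k : sorted leq b -> size b < k -> rook_number b k = 0.
Proof.
elim/last_ind: b k => [|b h IH] [|k] //; first by rewrite rook_number_nil.
rewrite sorted_leq_rcons size_rcons => /andP[bh /IH {}IH] bk.
have := rook_number_rcons k bh; rewrite !IH //; last exact: leqW.
by rewrite !muln0 !addn0.
Qed.

(** Both boards obey the same recurrence as columns are added on the right, so only the board of
    zero columns has to be computed. *)
Lemma rook_number_pad n b k : sorted leq b -> rook_number (pad n b) k = rook_number b k.
Proof.
rewrite /pad; move: (n - size b) => m {n}.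
have zeros_le h s : all (fun x => x <= h) (nseq m 0 ++ s) = all (fun x => x <= h) s.
  by rewrite all_cat all_nseq orbT.
elim/last_ind: b k => [|b h IH] k.
  move=> _; rewrite cats0 rook_number_nil.
  elim: m k {zeros_le} => [|m IH] [|k]; rewrite ?rook_number_nil ?rook_number0 //.
  have := @rook_number_rcons (nseq m 0) 0 k; rewrite all_nseq orbT => /(_ isT).
  have -> : rcons (nseq m 0) 0 = nseq m.+1 0 by elim: m {IH} => //= m ->.
  by rewrite !IH; case: k => [|k] /=; lia.
rewrite sorted_leq_rcons => /andP[bh sb].
case: k => [|k]; first by rewrite !rook_number0.
have := rook_number_rcons k bh.
have := @rook_number_rcons (nseq m 0 ++ b) h k; rewrite zeros_le => /(_ bh).
by rewrite -rcons_cat !IH //; lia.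
Qed.

Local Open Scope ring_scope.

Definition ffact_poly (m : nat) : {poly rat} := \prod_(i < m) ('X - (i%:R)%:P).

(** The factorial rook polynomial of Goldman, Joichi and White; with falling factorials in place of
    powers it splits into linear factors. *)
Definition rook_poly (b : seq nat) : {poly rat} :=
  \sum_(k < (size b).+1) (rook_number b k)%:R *: ffact_poly (size b - k).

Definition excess (b : seq nat) : seq int :=
  [seq (nth 0%N b i)%:Z - i%:Z | i <- iota 0 (size b)].

Lemma ffact_polyS m : ffact_poly m.+1 = ffact_poly m * ('X - (m%:R)%:P).
Proof. by rewrite /ffact_poly big_ord_recr. Qed.

Lemma size_ffact_poly m : size (ffact_poly m) = m.+1.
Proof. by rewrite size_prod_XsubC /index_enum -enumT size_enum_ord. Qed.

Lemma lead_coef_ffact_poly m : (ffact_poly m)`_m = 1.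
Proof.
have := lead_coef_prod_XsubC (index_enum 'I_m) xpredT (fun i : 'I_m => (i%:R : rat)).
by rewrite lead_coefE -/(ffact_poly m) size_ffact_poly.
Qed.

(** The falling factorials are monic of distinct degrees, so the top coefficient isolates [a 0] and
    induction does the rest. *)
Lemma ffact_poly_free n (a : nat -> rat) :
  \sum_(k < n.+1) a k *: ffact_poly (n - k) = 0 -> forall k, (k <= n)%N -> a k = 0.
Proof.
elim: n a => [|n IH] a; rewrite big_ord_recl subn0 => H.
  move=> [|//] _; move: H; rewrite big_ord0 addr0 => /(congr1 (fun p : {poly rat} => p`_0)).
  by rewrite coefZ lead_coef_ffact_poly mulr1 coef0.
have a0 : a 0%N = 0.
  move/(congr1 (fun p : {poly rat} => p`_n.+1)): H.
  rewrite coefD coefZ lead_coef_ffact_poly mulr1 coef0 coef_sum big1 ?addr0 // => k _.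
  by rewrite coefZ nth_default ?mulr0 // size_ffact_poly /= /bump /=; lia.
move: H; rewrite a0 scale0r add0r => H [//|k] kn.
by apply: (IH (fun k => a k.+1)).
Qed.

(** With n columns in [b], the recurrence contributes the factor h - k to the k-th term, and raising
    the falling factorial by one degree contributes X - (n - k). Their sum X + h - n does not depend
    on k. *)
Lemma rook_poly_rcons b h : sorted leq (rcons b h) ->
  rook_poly (rcons b h) = rook_poly b * ('X + (h%:R - (size b)%:R)%:P).
Proof.
rewrite sorted_leq_rcons => /andP[bh sb].
rewrite /rook_poly size_rcons; set n := size b.
have rE k : (rook_number (rcons b h) k.+1)%:R =
    (rook_number b k.+1)%:R + (h%:R - k%:R) * (rook_number b k)%:R :> rat.
  have /(congr1 (fun m => m%:R : rat)) := rook_number_rcons k bh.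
  rewrite !natrD !natrM => E; apply: (addIr (k%:R * (rook_number b k)%:R)).
  by rewrite E; ring.
rewrite big_ord_recl rook_number0.
under eq_bigr => k _ do rewrite rE scalerDl.
rewrite big_split /= addrA.
(* An index shift: the leading term is the one for k = 0, and the term with [rook_number b n.+1]
   vanishes. *)
have -> : 1%:R *: ffact_poly (n.+1 - 0) +
    \sum_(k < n.+1) (rook_number b k.+1)%:R *: ffact_poly (n.+1 - bump 0 k) =
    \sum_(k < n.+1) (rook_number b k)%:R *: ffact_poly (n.+1 - k).
  transitivity (\sum_(k < n.+2) (rook_number b k)%:R *: ffact_poly (n.+1 - k)).
    by rewrite [RHS]big_ord_recl rook_number0.
  by rewrite big_ord_recr /= rook_number_gt_size // scale0r addr0.
rewrite -big_split mulr_suml /=; apply: eq_bigr => k _.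
have kn : (k <= n)%N by rewrite -ltnS.
rewrite subSn // ffact_polyS /bump /= add1n subSS -!mul_polyC natrB // !rmorphM !rmorphB /=.
ring.
Qed.

Lemma excess_rcons b h : excess (rcons b h) = rcons (excess b) (h%:Z - (size b)%:Z).
Proof.
rewrite /excess size_rcons -addn1 iotaD map_cat /= add0n nth_rcons ltnn eqxx cats1.
congr rcons; apply/eq_in_map => i; rewrite mem_iota add0n /= => ib.
by rewrite nth_rcons ib.
Qed.

Lemma rook_poly_prod b : sorted leq b ->
  rook_poly b = \prod_(x <- [seq - (e%:~R : rat) | e <- excess b]) ('X - x%:P).
Proof.
elim/last_ind: b => [_|b h IH sb].
  rewrite /rook_poly big_ord_recl big_ord0 addr0 rook_number0 /= big_nil.
  by rewrite /ffact_poly big_ord0 scale1r.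
rewrite rook_poly_rcons // IH; last by move: sb; rewrite sorted_leq_rcons => /andP[].
rewrite excess_rcons map_rcons -cats1 big_cat big_seq1 /=; congr (_ * _).
by rewrite intrB polyCN opprK.
Qed.

(* Goldman, Joichi and White *)
Lemma rook_equivP b1 b2 : sorted leq b1 -> sorted leq b2 -> size b1 = size b2 ->
  rook_equiv b1 b2 <-> perm_eq (excess b1) (excess b2).
Proof.
move=> s1 s2 s12; split=> [eqr | peq].
  (* Equal products of monic linear factors have the same roots with multiplicity. *)
  have : rook_poly b1 = rook_poly b2.
    by rewrite /rook_poly s12; apply: eq_bigr => k _; rewrite eqr.
  rewrite !rook_poly_prod // => /prod_XsubC_eq; apply: perm_map_inj.
  by move=> x y /oppr_inj/intr_inj.
(* Conversely, equal excesses give equal polynomials, and independence of the falling factorials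
   recovers the rook numbers up to the number of columns; beyond it they are all 0. *)
have : rook_poly b1 = rook_poly b2.
  by rewrite !rook_poly_prod //; apply: perm_big; apply: perm_map.
move/eqP; rewrite -subr_eq0 /rook_poly s12 -sumrB.
under eq_bigr => k _ do rewrite -scalerBl.
move/eqP/(@ffact_poly_free _ (fun k => (rook_number b1 k)%:R - (rook_number b2 k)%:R)).
move=> H k; case: (leqP k (size b2)) => kb.
  by have /eqP := H k kb; rewrite subr_eq0 eqr_nat => /eqP.
by rewrite !rook_number_gt_size // s12.
Qed.

(** * Copies of K33 in transposition graphs of words *)

Local Open Scope nat_scope.

Definition diff_set (n : nat) (T : eqType) (u v : 'I_n -> T) : {set 'I_n} :=
  [set i | u i != v i].

Section Words.
Variables (n : nat) (T : eqType).
Implicit Types u v w : 'I_n -> T.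

Lemma diff_setC u v : diff_set u v = diff_set v u.
Proof. by apply/setP => i; rewrite !inE eq_sym. Qed.

Lemma diff_set_triangle v u w : diff_set u w \subset diff_set u v :|: diff_set v w.
Proof.
apply/subsetP => i; rewrite !inE -negb_and; apply: contraNN.
by move=> /andP[/eqP-> /eqP->].
Qed.

(** Outside [s] the words agree, so those letters cancel from the two multisets. *)
Lemma perm_eq_on_diff_set u v (s : seq 'I_n) : perm_eq (codom u) (codom v) -> uniq s ->
  {subset diff_set u v <= s} -> perm_eq (map u s) (map v s).
Proof.
move=> puv us sub.
pose t := filter [predC s] (enum 'I_n).
have pst : perm_eq (enum 'I_n) (s ++ t).
  apply: uniq_perm; first exact: enum_uniq.
    rewrite cat_uniq us filter_uniq ?enum_uniq // andbT.
    by apply/hasPn => i; rewrite mem_filter => /andP[].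
  by move=> i; rewrite mem_enum mem_cat (mem_filter [predC s]) mem_enum inE /= andbT orbN.
have tE : map u t = map v t.
  apply/eq_in_map => i; rewrite mem_filter => /andP[/= si _].
  by apply/eqP; apply: contraNT si => uv; apply: sub; rewrite inE.
rewrite -(perm_cat2r (map u t)) {2}tE -!map_cat.
rewrite -(permPl (perm_map u pst)).
by rewrite perm_sym -(permPl (perm_map v pst)) perm_sym.
Qed.

Lemma card_diff_set_neq1 u v : perm_eq (codom u) (codom v) -> #|diff_set u v| != 1.
Proof.
move=> puv; apply/negP => /cards1P[i Di].
have sub : {subset diff_set u v <= [:: i]} by move=> j; rewrite Di !inE.
have /perm_mem/(_ (u i)) := perm_eq_on_diff_set puv (isT : uniq [:: i]) sub.
have: i \in diff_set u v by rewrite Di inE.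
rewrite inE => nuv.
by rewrite !inE eqxx (negPf nuv).
Qed.

(** A position changed from [u] to [v] and then back would lie in both two-element difference sets,
    leaving at most one further position in each, hence at most two where [u] and [w] differ. *)
Lemma diff_set_sub3 u v w : #|diff_set u v| = 2 -> #|diff_set v w| = 2 ->
  #|diff_set u w| = 3 -> diff_set u v \subset diff_set u w.
Proof.
move=> uv vw uw; apply/subsetP => i iuv; rewrite inE; apply/eqP => ui.
have ivw : i \in diff_set v w by move: iuv; rewrite !inE ui eq_sym.
have sub : diff_set u w \subset (diff_set u v :\ i) :|: (diff_set v w :\ i).
  apply/subsetP => j juw; have := subsetP (diff_set_triangle v u w) j juw.
  have ji : j != i by apply: contraTneq juw => ->; rewrite inE ui eqxx.
  by rewrite !inE ji.
have := subset_leq_card sub; rewrite cardsU uw.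
have := cardsD1 i (diff_set u v); rewrite iuv uv.
have := cardsD1 i (diff_set v w); rewrite ivw vw.
by lia.
Qed.

(** Four differences from two pairs force the pairs to be disjoint, so a position touched by the
    first step is left alone by the second. *)
Lemma diff_set_disjoint4 u v w i : #|diff_set u v| = 2 -> #|diff_set v w| = 2 ->
  #|diff_set u w| = 4 -> i \in diff_set u v -> i \in diff_set u w /\ v i = w i.
Proof.
move=> uv vw uw iuv.
have E : diff_set u w = diff_set u v :|: diff_set v w.
  apply/eqP; rewrite eqEcard diff_set_triangle uw cardsU uv vw; lia.
split; first by rewrite E inE iuv.
have : #|diff_set u v :&: diff_set v w| = 0.
  by move: uw; rewrite E cardsU uv vw; lia.
move/eqP; rewrite cards_eq0 => /eqP/setP/(_ i); rewrite in_setI iuv in_set0 /=.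
by rewrite inE => /negbFE/eqP.
Qed.

(** Two words on one side differ in at least three positions, since 0, 1 and 2 are excluded, and in
    at most four because they have a common neighbour. Four is impossible, and with three the
    differences of all neighbours from [ord0] lie in those three positions. *)
Lemma K33_support (w : 'I_6 -> 'I_n -> T) :
    (forall a b, perm_eq (codom (w a)) (codom (w b))) ->
    (forall a b, w a =1 w b -> a = b) ->
    (forall a b, (#|diff_set (w a) (w b)| == 2) = ((a < 3) != (b < 3))) ->
  exists2 S : {set 'I_n}, #|S| = 3 & forall a, diff_set (w ord0) (w a) \subset S.
Proof.
move=> wP wI wE; pose D a b := diff_set (w a) (w b).
have far (a b : 'I_6) : a != b -> (a < 3) = (b < 3) -> 2 < #|D a b|.
  move=> ab sab; have := card_diff_set_neq1 (wP a b); have := wE a b.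
  rewrite sab eqxx /D; case: #|_| (cards_eq0 (diff_set (w a) (w b))) => [|[|[]]] //.
  rewrite eqxx => /esym/eqP D0; case/eqP: ab; apply: wI => i.
  by apply/eqP; apply: contraFT (in_set0 i); rewrite -D0 inE.
have near (a b : 'I_6) : (a < 3) != (b < 3) -> #|D a b| = 2 by rewrite -wE => /eqP.
pose o k (h : k < 6) : 'I_6 := Ordinal h.
pose c0 := @o 3 isT; pose c1 := @o 4 isT; pose c2 := @o 5 isT.
(* If [c] and [c'] both changed position [p], both would already carry the letter of [a] there; they
   would then differ in at most two positions, too few for words on the same side. *)
have meet3 (a c c' : 'I_6) : a < 3 -> a != ord0 -> 2 < c -> 2 < c' -> c != c' ->
    #|D ord0 a| = 4 -> [disjoint D ord0 c & D ord0 c'].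
  move=> a3 a0 c3 c'3 cc' D4; apply/pred0P => p; apply/negP => /andP[/= pc pc'].
  have nc : (c < 3) = false by apply/negbTE; rewrite -leqNgt.
  have nc' : (c' < 3) = false by apply/negbTE; rewrite -leqNgt.
  have n0c : #|D ord0 c| = 2 by rewrite near // nc.
  have nca : #|D c a| = 2 by rewrite near // nc a3.
  have n0c' : #|D ord0 c'| = 2 by rewrite near // nc'.
  have nc'a : #|D c' a| = 2 by rewrite near // nc' a3.
  have [_ e] := diff_set_disjoint4 n0c nca D4 pc.
  have [_ e'] := diff_set_disjoint4 n0c' nc'a D4 pc'.
  have sub : D c c' \subset (D ord0 c :\ p) :|: (D ord0 c' :\ p).
    apply/subsetP => j jcc'.
    have := subsetP (diff_set_triangle (w ord0) (w c) (w c')) j jcc'.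
    have jp : j != p.
      by apply: contraTneq jcc' => ->; rewrite inE e e' eqxx.
    by rewrite [diff_set (w c) _]diff_setC !inE jp.
  have := subset_leq_card sub; rewrite cardsU.
  have := far c c' cc'; rewrite nc nc' => /(_ erefl).
  have := cardsD1 p (D ord0 c); rewrite pc n0c.
  have := cardsD1 p (D ord0 c'); rewrite pc' n0c'.
  by lia.
have card3 (a : 'I_6) : a < 3 -> a != ord0 -> #|D ord0 a| = 3.
  move=> a3 a0.
  have D2 (c : 'I_6) : 2 < c -> #|D ord0 c| = 2 /\ #|D c a| = 2.
    by move=> c3; split; apply: near; rewrite ?a3 /=; lia.
  have lt4 : #|D ord0 a| <= 4.
    have [e e'] := D2 c0 isT.
    have := subset_leq_card (diff_set_triangle (w c0) (w ord0) (w a)).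
    by rewrite cardsU -/(D ord0 a) -/(D ord0 c0) -/(D c0 a) e e'; lia.
  have gt2 : 2 < #|D ord0 a| by apply: far; rewrite ?a3 // eq_sym.
  (* At distance four, the three neighbours would give three disjoint pairs inside four
     positions. *)
  suff : #|D ord0 a| <> 4 by lia.
  move=> D4.
  have d01 := @meet3 a c0 c1 a3 a0 isT isT isT D4.
  have d02 := @meet3 a c0 c2 a3 a0 isT isT isT D4.
  have d12 := @meet3 a c1 c2 a3 a0 isT isT isT D4.
  have sub : D ord0 c0 :|: (D ord0 c1 :|: D ord0 c2) \subset D ord0 a.
    have s (c : 'I_6) : 2 < c -> D ord0 c \subset D ord0 a.
      move=> /D2[e e']; apply/subsetP => i ic.
      by have [] := diff_set_disjoint4 e e' D4 ic.
    by rewrite !subUset !s.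
  have /eqP e12 : #|D ord0 c1 :|: D ord0 c2| == #|D ord0 c1| + #|D ord0 c2|.
    by rewrite leq_card_setU.
  have /eqP e012 : #|D ord0 c0 :|: (D ord0 c1 :|: D ord0 c2)| ==
      #|D ord0 c0| + #|D ord0 c1 :|: D ord0 c2|.
    by rewrite leq_card_setU -setI_eq0 setIUr setU_eq0 !setI_eq0 d01.
  have := subset_leq_card sub; rewrite D4 e012 e12.
  by rewrite (D2 c0 isT).1 (D2 c1 isT).1 (D2 c2 isT).1.
(* [U] is independent of [a]. It contains the difference set of [c0] and [c1], hence at least three
   positions, so it fills each three-element [D ord0 a]. *)
pose U := D ord0 c0 :|: D ord0 c1.
have subU (a : 'I_6) : a < 3 -> a != ord0 -> U = D ord0 a.
  move=> a3 a0; apply/eqP; rewrite eqEcard card3 // subUset.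
  have s (c : 'I_6) : 2 < c -> D ord0 c \subset D ord0 a.
    by move=> c3; apply: diff_set_sub3 (card3 a a3 a0); apply: near; rewrite ?a3 /=; lia.
  rewrite !s //=.
  have := far c0 c1 isT erefl.
  move/leq_trans; apply; apply: subset_leq_card.
  by have := diff_set_triangle (w ord0) (w c0) (w c1); rewrite [diff_set (w c0) (w ord0)]diff_setC.
exists U; first by rewrite (subU (@o 1 isT)) // card3.
move=> a; case: (ltnP a 3) => a3.
  have [->|a0] := eqVneq a ord0; last by rewrite (subU a).
  by apply/subsetP => i; rewrite inE eqxx.
rewrite (subU (@o 1 isT)) //; apply: diff_set_sub3 (card3 (@o 1 isT) isT isT).
  by apply: near; rewrite /=; lia.
by apply: near; rewrite /=; lia.
Qed.

End Words.

(** * Arrangements of three letters *)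

Lemma perm_swap2 (T : eqType) (x y : T) : perm_eql [:: x; y] [:: y; x].
Proof. exact: (perm_catC [:: x] [:: y]). Qed.

Lemma perm_eq_pair (T : eqType) (a b x y : T) :
  perm_eq [:: a; b] [:: x; y] -> a = x /\ b = y \/ a = y /\ b = x.
Proof.
move=> P; have := perm_mem P a; rewrite !inE eqxx /= => /esym/orP[]/eqP E; subst a.
  by left; split=> //; move: P; rewrite perm_cons => /perm_mem/(_ b); rewrite !inE eqxx => /esym/eqP.
right; split=> //; move: P; rewrite perm_sym perm_swap2 perm_cons.
by move=> /perm_mem/(_ b); rewrite !inE eqxx => /eqP.
Qed.

Definition arrangements3 (T : Type) (x y z : T) : seq (seq T) :=
  [:: [:: x; y; z]; [:: x; z; y]; [:: y; x; z]; [:: y; z; x]; [:: z; x; y]; [:: z; y; x]].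

Lemma mem_arrangements3 (T : eqType) (x y z : T) l :
  (l \in arrangements3 x y z) = perm_eq l [:: x; y; z].
Proof.
have Pyxz : perm_eql [:: x; y; z] [:: y; x; z] by exact: (perm_catCA [:: x] [:: y] [:: z]).
have Pzxy : perm_eql [:: x; y; z] [:: z; x; y] by exact: (perm_catC [:: x; y] [:: z]).
apply/idP/idP.
  rewrite perm_sym !inE => /or4P[|||/or3P[]] /eqP->.
  - by [].
  - by rewrite perm_cons perm_swap2.
  - by rewrite Pyxz.
  - by rewrite Pyxz perm_cons perm_swap2.
  - by rewrite Pzxy.
  - by rewrite Pzxy perm_cons perm_swap2.
move=> P; have := perm_size P; case: l P => [|a [|b [|c [|]]]] // P _.
have := perm_mem P a; rewrite !inE eqxx /= => /esym/or3P[]/eqP E; subst a; move: P.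
- rewrite perm_cons => /perm_eq_pair[] [-> ->]; by rewrite eqxx ?orbT.
- rewrite perm_sym Pyxz perm_cons perm_sym => /perm_eq_pair[] [-> ->]; by rewrite eqxx ?orbT.
- rewrite perm_sym Pzxy perm_cons perm_sym => /perm_eq_pair[] [-> ->]; by rewrite eqxx ?orbT.
Qed.

(** Six distinct triples inside a list of length six exhaust it and show it to be duplicate-free; a
    repeated letter would make two of its entries coincide. *)
Lemma six_arrangements (T : eqType) (x y z : T) (t : 'I_6 -> seq T) :
    injective t -> (forall a, perm_eq (t a) [:: x; y; z]) ->
  uniq [:: x; y; z] /\ forall l, perm_eq l [:: x; y; z] -> exists a, t a = l.
Proof.
move=> tI tP.
have sub : {subset codom t <= arrangements3 x y z}.
  by move=> _ /codomP[a ->]; rewrite mem_arrangements3.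
have ut : uniq (codom t) by apply/injectiveP.
have st : size (arrangements3 x y z) <= size (codom t) by rewrite size_codom card_ord.
split.
  have := leq_size_uniq ut sub st; rewrite /= !inE !eqseq_cons !eqxx /= !andbT.
  by case: (eqVneq x y) => //=; case: (eqVneq x z) => //=; case: (eqVneq y z).
move=> l; rewrite -mem_arrangements3.
have [_ <-] := uniq_min_size ut sub st.
by move=> /codomP[a ->]; exists a.
Qed.

(** * Padding, and edges as transpositions of excess words *)

Lemma size_pad n b : size b <= n -> size (pad n b) = n.
Proof. by move=> bn; rewrite size_cat size_nseq subnK. Qed.

Lemma sorted_pad n b : sorted leq b -> sorted leq (pad n b).
Proof.
rewrite /pad; elim: (n - size b) => //= m IH /IH.
by case: (nseq m 0 ++ b).
Qed.

Lemma nth_pad m n b i : size b <= m -> m <= n ->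
  nth 0 (pad n b) i = if i < n - m then 0 else nth 0 (pad m b) (i - (n - m)).
Proof.
move=> bm mn; rewrite /pad !nth_cat !size_nseq !nth_nseq.
case: (ltnP i (n - m)) => h1; case: ltnP => h2; rewrite ?if_same //; try lia.
  by rewrite ifT //; lia.
by rewrite ifF; [congr nth; lia | lia].
Qed.

Lemma filter_pad n b : all (fun h => 0 < h) b -> filter (fun h => 0 < h) (pad n b) = b.
Proof.
move=> /all_filterP b0; rewrite filter_cat b0.
by elim: (n - size b) => //= m.
Qed.

(** In a sorted sequence the zeros all come first, so padding puts back exactly those removed. *)
Lemma pad_filter b : sorted leq b -> pad (size b) (filter (fun h => 0 < h) b) = b.
Proof.
elim: b => //= x b IH; case: (posnP x) => [-> /path_sorted/IH E|x0 sb].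
  rewrite -[X in _ = _ :: X]E /pad subSn //.
  by rewrite size_filter count_size.
have /all_filterP b0 : all (fun h => 0 < h) b.
  move: sb; rewrite (path_sortedE leq_trans) => /andP[+ _].
  by apply: sub_all => h; apply: leq_trans.
by rewrite b0 /pad subnn.
Qed.

(** Edges are defined at the larger of two lengths; this moves them to any common [n], so that all
    six boards can share one length. *)
Lemma rook_edge_pad n b1 b2 : size b1 <= n -> size b2 <= n ->
  rook_edge b1 b2 <->
  exists i j k, [/\ i < n, j < n, i != j & 0 < k] /\
    [/\ nth 0 (pad n b1) i = nth 0 (pad n b2) i + k,
        nth 0 (pad n b1) j + k = nth 0 (pad n b2) j &
    forall l, l < n -> l != i -> l != j -> nth 0 (pad n b1) l = nth 0 (pad n b2) l].
Proof.
move=> b1n b2n; rewrite /rook_edge; set m := maxn _ _.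
have b1m : size b1 <= m by apply: leq_maxl.
have b2m : size b2 <= m by apply: leq_maxr.
have mn : m <= n by rewrite geq_max b1n.
have E1 i := nth_pad i b1m mn; have E2 i := nth_pad i b2m mn.
split=> -[i [j [k [[im jm ij k0] [ei ej el]]]]].
  exists (i + (n - m)), (j + (n - m)), k; rewrite !E1 !E2.
  have nlt l : (l + (n - m) < n - m) = false by lia.
  rewrite !nlt !addnK; split; first by split=> //; lia.
  split=> // l ln li lj; rewrite E1 E2; case: ltnP => // lnm.
  by apply: el; lia.
move: ei ej; rewrite !E1 !E2.
(* A column added by the padding has height 0 in both boards and cannot account for a difference
   [k > 0]. *)
case: ltnP => [_|inm]; first by lia.
case: ltnP => [_|jnm]; first by lia.
move=> ei ej; exists (i - (n - m)), (j - (n - m)), k; split; first by split=> //; lia.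
split=> // l ln li lj.
have nlt : (l + (n - m) < n - m) = false by lia.
by have := el (l + (n - m)); rewrite E1 E2 addnK nlt; apply; lia.
Qed.

Definition excess_word (n : nat) (b : seq nat) (i : 'I_n) : int :=
  ((nth 0%N (pad n b) i)%:Z - i%:Z)%R.

Lemma codom_excess_word n b : size b <= n -> codom (excess_word (n := n) b) = excess (pad n b).
Proof.
move=> bn; rewrite codomE /excess size_pad // -val_enum_ord -map_comp.
by apply: eq_map.
Qed.

(** For rearrangements, differing in exactly two positions means that the two letters are exchanged,
    so one column gains what the other loses. *)
Lemma rook_edge_diff_set n b1 b2 : size b1 <= n -> size b2 <= n ->
    perm_eq (codom (excess_word (n := n) b1)) (codom (excess_word (n := n) b2)) ->
  rook_edge b1 b2 <-> #|diff_set (excess_word (n := n) b1) (excess_word b2)| = 2.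
Proof.
move=> b1n b2n P; rewrite (rook_edge_pad b1n b2n); split.
  move=> [i [j [k [[im jm ij k0] [ei ej el]]]]].
  suff -> : diff_set (excess_word b1) (excess_word b2) = [set Ordinal im; Ordinal jm].
    by rewrite cards2 -val_eqE /= ij.
  apply/setP => l; rewrite !inE /excess_word -!val_eqE /=.
  have := el l (ltn_ord l).
  case: (eqVneq (val l) i) => [->|li]; first by rewrite ei /= => _; lia.
  case: (eqVneq (val l) j) => [->|lj]; first by rewrite -ej /= => _; lia.
  by move=> /(_ isT isT) ->; rewrite eqxx.
move=> /eqP/cards2P[i [j [ij D]]].
have uij : uniq [:: i; j] by rewrite /= inE ij.
have sub : {subset diff_set (excess_word (n := n) b1) (excess_word b2) <= [:: i; j]}.
  by move=> l; rewrite D !inE.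
have := perm_eq_on_diff_set P uij sub.
have: i \in diff_set (excess_word b1) (excess_word b2) by rewrite D !inE eqxx.
rewrite inE => ni.
case/perm_eq_pair => [[e _]|]; first by rewrite e eqxx in ni.
move: ni; rewrite /excess_word => ni [e1 e2].
have el l : l < n -> l != i -> l != j -> nth 0 (pad n b1) l = nth 0 (pad n b2) l.
  move=> ln li lj; have : Ordinal ln \notin diff_set (excess_word b1) (excess_word b2).
    by rewrite D !inE negb_or -!val_eqE li lj.
  by rewrite inE negbK /excess_word /= => /eqP; lia.
(* An edge names first the column where [b1] is higher, which decides the order of [i] and [j]. *)
have [ni'|] : nth 0 (pad n b2) i < nth 0 (pad n b1) i \/ nth 0 (pad n b1) i < nth 0 (pad n b2) i.
  by lia.
  exists i, j, (nth 0 (pad n b1) i - nth 0 (pad n b2) i); split; split=> //; lia.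
move=> ni'; exists j, i, (nth 0 (pad n b2) i - nth 0 (pad n b1) i).
by split; split=> //; [rewrite eq_sym | lia | lia | lia | move=> l ln lj li; apply: el].
Qed.

(** * Construction of the seventh board *)

Lemma sorted_nth_le b i j : sorted leq b -> i <= j -> j < size b -> nth 0 b i <= nth 0 b j.
Proof.
move=> sb ij jb; apply: (sorted_leq_nth leq_trans leqnn) => //; rewrite inE //.
exact: leq_ltn_trans jb.
Qed.

(* Moves the letter at [p] to [q - 1], shifting the letters in between to the left. *)
Definition rotl_index (p q i : nat) : nat :=
  if (p <= i) && (i.+1 < q) then i.+1 else if i.+1 == q then p else i.

Lemma perm_rotl_index n p q : p < q -> q < n ->
  perm_eq (map (rotl_index p q) (iota 0 n)) (iota 0 n).
Proof.
move=> pq qn.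
have lt i : i < n -> rotl_index p q i < n.
  by rewrite /rotl_index; case: ifP; [lia | case: eqP; lia].
have u : uniq (map (rotl_index p q) (iota 0 n)).
  rewrite map_inj_in_uniq ?iota_uniq // => i j _ _; rewrite /rotl_index.
  by repeat case: ifP => ?; lia.
have sub : {subset map (rotl_index p q) (iota 0 n) <= iota 0 n}.
  by move=> _ /mapP[i + ->]; rewrite !mem_iota /= add0n => /lt.
apply: uniq_perm (iota_uniq _ _) _ => //.
by have [] := uniq_min_size u sub; rewrite ?size_map.
Qed.

(** Here [b] carries x, y, z at [p], [q], [s], while [c] carries z at [p] and x at [q]. The new
    board keeps y and z in place but has a letter above x at [p], which no arrangement of x, y, z
    allows. *)
Lemma rotated_board b c p q s (e : nat -> int) (e' : nat -> int) :
    (forall i, e i = (nth 0%N b i)%:Z - i%:Z)%R -> (forall i, e' i = (nth 0%N c i)%:Z - i%:Z)%R ->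
    sorted leq b -> sorted leq c -> size c = size b -> p < q -> q < s -> s < size b ->
    (forall i, i < size b -> i \notin [:: p; q; s] -> e i = e' i) ->
    (e p < e q)%R -> (e q < e s)%R -> e' p = e s -> e' q = e p ->
  exists2 d, [/\ sorted leq d, size d = size b & perm_eq (excess d) (excess b)] &
    (e p < (nth 0%N d p)%:Z - p%:Z)%R /\
    forall i, i < size b -> i < p \/ q <= i -> nth 0 d i = nth 0 b i.
Proof.
move=> eE e'E sb sc cb pq qs sn eq_off epq eqs e'p e'q.
set n := size b in sn eq_off *.
have step (f : nat -> int) a : (forall i, f i = (nth 0%N a i)%:Z - i%:Z)%R -> sorted leq a ->
    size a = n -> forall i, i.+1 < n -> (f i <= f i.+1 + 1)%R.
  move=> fE sa an i i1; have := @sorted_nth_le a i i.+1 sa (leqnSn _).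
  by rewrite an !fE => /(_ i1); lia.
have eS := step e b eE sb erefl; have e'S := step e' c e'E sc cb.
(* Were [q] next to [p], the word of [c] would drop from z to x in one step, by at least 2. *)
have p1q : p.+1 < q.
  have := e'S p; rewrite e'p => H.
  rewrite ltn_neqAle pq andbT; apply/eqP => E.
  by move: H; rewrite E e'q => /(_ ltac:(lia)); lia.
(* Strictly between [p] and [q] the two words agree, so the board inequalities of [c] next to z and
   x bound the letters of [b]. *)
have ep1 : (e s <= e p.+1 + 1)%R.
  rewrite (eq_off p.+1) ?inE; [rewrite -e'p; apply: e'S | |]; lia.
have eq1 : (e q.-1 <= e p + 1)%R.
  have := e'S q.-1; rewrite prednK ?e'q; last lia.
  rewrite (eq_off q.-1) ?inE; [apply | |]; lia.
have epS : 0 < p -> (e p.-1 <= e p + 1)%R.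
  by move=> p0; have := eS p.-1; rewrite prednK //; apply; lia.
pose r := rotl_index p q.
(* The absolute value changes nothing on the board: a letter moved one place left lowers its column
   by 1, and these columns are positive because column [p.+1] is higher than column [p]. *)
pose g i := absz (e (r i) + i%:Z)%R.
have gE i : i < n -> ((g i)%:Z = e (r i) + i%:Z)%R.
  move=> i_n; rewrite /g gez0_abs // /r /rotl_index.
  case: ifP => [/andP[pi iq]|_]; last by case: eqP => ?; rewrite eE; lia.
  have := @sorted_nth_le b p.+1 i.+1 sb; have := eE p; have := eE p.+1; have := eE i.+1.
  by rewrite -/n; lia.
have nthg i : i < n -> nth 0 (mkseq g n) i = g i by move=> i_n; rewrite nth_mkseq.
exists (mkseq g n); last split.
- split; last 2 first.
  + by rewrite size_mkseq.
  + have -> : excess (mkseq g n) = map e (map r (iota 0 n)).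
      rewrite /excess size_mkseq -map_comp; apply/eq_in_map => i; rewrite mem_iota add0n /= => i_n.
      by rewrite nthg // gE //; lia.
    have -> : excess b = map e (iota 0 n) by apply: eq_map => i; rewrite eE.
    by apply/perm_map/perm_rotl_index; lia.
  apply/(sortedP 0) => i; rewrite size_mkseq => i1; rewrite !nthg //; last exact: ltnW.
  rewrite -lez_nat !gE //; last exact: ltnW.
  (* At most three adjacencies are new: those ending at [p], at [q.-1] and at [q]. They follow from
     [epS] with [ep1], from [eq1], and from x < y. *)
  suff : (e (r i) <= e (r i.+1) + 1)%R by lia.
  rewrite /r /rotl_index.
  case: ifP => [/andP[pi iq]|npq].
    case: ifP => [/andP[_ iq']|]; first by apply: eS; lia.
    move=> _; case: eqP => [E|nE]; last lia.
    by have <- : q.-1 = i.+1 by lia.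
  case: eqP => [E|nE].
    rewrite ifF; last lia.
    by rewrite ifF ?E; [lia | lia].
  case: ifP => [pi|_].
    have E : i.+1 = p by lia.
    by have := epS; rewrite -E /= => /(_ isT); rewrite E; lia.
  case: eqP => [E|_]; last exact: eS.
  by lia.
- by rewrite nthg ?gE /r /rotl_index ?leqnn ?p1q /=; lia.
move=> i i_n ipq; rewrite nthg //.
suff : ((g i)%:Z = (nth 0%N b i)%:Z)%R by case.
have rE : r i = i by rewrite /r /rotl_index; case: ifP; [lia | case: eqP; lia].
by rewrite gE // rE eE; lia.
Qed.

(** * Ordering the positions and letters, and the contradiction *)

Lemma sorted_triple n (S : {set 'I_n}) : #|S| = 3 ->
  exists p q s : 'I_n, [/\ p < q, q < s & {subset S <= [:: p; q; s]}].
Proof.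
move=> S3.
have srt : sorted ltn (map val (enum S)).
  apply: (subseq_sorted ltn_trans (s2 := map val (enum 'I_n))).
    by apply: map_subseq; rewrite [X in subseq _ X]enumT; apply: filter_subseq.
  by rewrite val_enum_ord iota_ltn_sorted.
have mS i : (i \in S) = (i \in enum S) by rewrite mem_enum.
move: S3 srt mS; rewrite cardE.
case: (enum S) => [|p [|q [|s [|]]]] //= _ /and3P[pq qs _] mS.
by exists p, q, s; split=> // i; rewrite mS.
Qed.

Lemma sorted_values (t : seq int) : size t = 3 ->
  exists x y z : int, [/\ (x <= y)%R, (y <= z)%R & perm_eq t [:: x; y; z]].
Proof.
move=> t3; have := sort_le_sorted t; have := size_sort <=%O t; have := perm_sort <=%O t.
rewrite t3; case: (sort _ t) => [|x [|y [|z [|]]]] //= P _ /and3P[xy yz _].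
by exists x, y, z; rewrite perm_sym P.
Qed.

Theorem theorem13 (B : seq nat) : ferrers B -> ~ rook_graph_iso_K33 B.
Proof.
move=> _ [f [fI fV fS fE]].
have [fsort fpos] : (forall a, sorted leq (f a)) /\ (forall a, all (fun h => 0 < h) (f a)).
  by split=> a; have [/andP[]] := fV a.
pose n := \max_(a < 6) size (f a).
have fn a : size (f a) <= n by apply: leq_bigmax.
pose w (a : 'I_6) : 'I_n -> int := excess_word (f a).
have wP a b : perm_eq (codom (w a)) (codom (w b)).
  rewrite !codom_excess_word //.
  apply/rook_equivP; rewrite ?sorted_pad ?size_pad // => k.
  by rewrite !rook_number_pad // -(proj2 (fV a)) (proj2 (fV b)).
have eq_pad a c : size c = n -> (forall i, i < n -> nth 0 (pad n (f a)) i = nth 0 c i) ->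
    pad n (f a) = c.
  by move=> cn H; apply: (@eq_from_nth _ 0) => [|i]; rewrite size_pad ?cn // => /H.
have wI a b : w a =1 w b -> a = b.
  (* Vertices have no zero columns, so filtering out zeros recovers each board from its padded
     form. *)
  move=> wab; apply: fI; rewrite -(filter_pad n (fpos a)) -(filter_pad n (fpos b)).
  congr filter; apply: eq_pad => [|i i_n]; first exact: size_pad.
  by have := wab (Ordinal i_n); rewrite /w /excess_word /=; lia.
have wE a b : (#|diff_set (w a) (w b)| == 2) = ((a < 3) != (b < 3)).
  have H := rook_edge_diff_set (fn a) (fn b) (wP a b).
  by apply/eqP/idP => [/H/fE|/fE/H].
have [S S3 wS] := K33_support wP wI wE.
have [p [q [s [pq qs Spqs]]]] := sorted_triple S3.
pose tr a := map (w a) [:: p; q; s].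
have upqs : uniq [:: p; q; s] by rewrite /= !inE -!val_eqE /=; lia.
have off a i : i \notin [:: p; q; s] -> w ord0 i = w a i.
  move=> ni; apply/eqP; apply: contraNT ni => ne; apply: Spqs.
  by apply: (subsetP (wS a)); rewrite inE.
have trI : injective tr.
  move=> a b /eq_in_map E; apply: wI => i.
  by case: (boolP (i \in [:: p; q; s])) => [/E//|ni]; rewrite -!off.
have trP a : perm_eq (tr a) (tr ord0).
  rewrite perm_sym; apply: perm_eq_on_diff_set => // i iD.
  by apply: Spqs; apply: (subsetP (wS a)).
have [x [y [z [xy yz Pxyz]]]] := @sorted_values (tr ord0) erefl.
have trxyz a : perm_eq (tr a) [:: x; y; z] by apply: perm_trans (trP a) Pxyz.
have [uxyz arr] := six_arrangements trI trxyz.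
(* Since every arrangement occurs, [a1] realises x, y, z and [a2] realises z, x, y: the two boards
   that [rotated_board] takes. *)
have [a1 [p1 q1 s1]] := arr _ (perm_refl _).
have Pzxy : perm_eq [:: z; x; y] [:: x; y; z].
  by rewrite perm_sym; apply/permPl; exact: (perm_catC [:: x; y] [:: z]).
have [a2 [p2 q2 _]] := arr _ Pzxy.
have [xy' yz'] : (x < y)%R /\ (y < z)%R.
  by move: uxyz; rewrite /= !inE; lia.
pose e a (i : nat) := ((nth 0%N (pad n (f a)) i)%:Z - i%:Z)%R.
have [] := @rotated_board (pad n (f a1)) (pad n (f a2)) p q s (e a1) (e a2);
  rewrite ?sorted_pad ?size_pad //.
- move=> i i_n ni; have := @off _ (Ordinal i_n); rewrite /w /excess_word => H.
  rewrite /e -(H a1) ?(H a2) //; move: ni; by rewrite !inE -!val_eqE.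
- by rewrite -[e a1 p]/(w a1 p) -[e a1 q]/(w a1 q) p1 q1.
- by rewrite -[e a1 q]/(w a1 q) -[e a1 s]/(w a1 s) q1 s1.
- by rewrite -[e a2 p]/(w a2 p) -[e a1 s]/(w a1 s) p2 s1.
- by rewrite -[e a2 q]/(w a2 q) -[e a1 p]/(w a1 p) q2 p1.
move=> d [sd dn Pd] [dp deq].
(* Vertices are reduced boards, so the zero columns of [d] are stripped; padding to [n] restores
   them. *)
pose C := filter (fun h => 0 < h) d.
have padC : pad n C = d by rewrite -dn pad_filter.
have sC : sorted leq C by apply: sorted_filter leq_trans _ _ sd.
have VC : rook_vertex B C.
  split; first by rewrite /reduced_ferrers /ferrers sC filter_all.
  move=> k; rewrite (proj2 (fV a1)) -(@rook_number_pad n C) // padC.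
  rewrite -(@rook_number_pad n (f a1)) //; apply/esym; move: k.
  by apply/rook_equivP; rewrite ?sorted_pad ?size_pad.
have [a fa] := fS C VC.
have := trxyz a.
(* As one of the six vertices, the new board must arrange x, y, z; with y at [q] and z at [s] it has
   x at [p], against [dp]. *)
have wq : w a q = y.
  by rewrite -q1 /w /excess_word fa padC deq // leqnn; right.
have ws : w a s = z.
  by rewrite -s1 /w /excess_word fa padC deq //; right; apply: ltnW.
rewrite /tr /= wq ws => P.
have : perm_eq ([:: w a p] ++ [:: y; z]) ([:: x] ++ [:: y; z]) by [].
rewrite perm_cat2r => /perm_mem/(_ x); rewrite !inE eqxx => /eqP E.
move: dp; rewrite -padC -fa -[e a1 p]/(w a1 p) p1 E -/(w a p).
by rewrite /w /excess_word ltxx.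
Qed.
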